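(* One has $v({\rm SDP})=v({\rm UQ})$ under one of the following conditions: (i) $a_0\notin {\rm conv}\{a_1,\dots,a_p\}$; (ii) $\{x\in\mathbb{R}^n: (a_i-a_0)^Tx\ge 0,\ i=1,\dots,p\}\ne\{0\}$. (That is, each of (i), (ii) on its own is sufficient.)
   Context: Let $n,p\ge1$, $a_0,a_1,\dots,a_p\in\mathbb{R}^n$ and $b_1,\dots,b_p\in\mathbb{R}$. The uniform quadratic optimization problem is $$({\rm UQ})\quad \max\ f_0(x)=x^Tx-2a_0^Tx\quad\text{s.t. } x\in\Omega_1:=\{x\in\mathbb{R}^n: x^Tx-2a_i^Tx+b_i\le 0,\ i=1,\dots,p\}.$$ Standing assumption (Slater's condition): $\Omega_1$ has nonempty interior. Its semidefinite relaxation, with variables $x\in\mathbb{R}^n$ and $Y$ a real symmetric $n\times n$ matrix, is $$({\rm SDP})\quad \max\ {\rm Tr}(Y)-2a_0^Tx\quad\text{s.t. } {\rm Tr}(Y)-2a_i^Tx+b_i\le 0,\ i=1,\dots,p,\qquad \begin{pmatrix} Y & x \\ x^T & 1 \end{pmatrix}\succeq 0,$$ where $\succeq0$ means positive semidefinite. $v(\cdot)$ denotes the optimal value of a problem and ${\rm conv}$ the convex hull. *)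

(* Defs.v *)
From mathcomp Require Import all_boot all_order all_algebra.
From mathcomp Require Import all_classical all_reals all_analysis.

Set Implicit Arguments.
Unset Strict Implicit.
Unset Printing Implicit Defensive.

Import Order.TTheory GRing.Theory Num.Theory.
Import numFieldNormedType.Exports.

Local Open Scope classical_set_scope.
Local Open Scope ring_scope.

Definition dotp (R : realType) (n : nat) (u v : 'cV[R]_n) : R :=
  (u^T *m v) 0 0.

Definition psdmx (R : realType) (m : nat) (A : 'M[R]_m) : Prop :=
  A^T = A /\ forall v : 'cV[R]_m, 0 <= (v^T *m A *m v) 0 0.

Definition conv_hull (R : realType) (n p : nat) (a : 'I_p -> 'cV[R]_n) :
    set 'cV[R]_n :=
  [set x | exists l : 'I_p -> R,
     [/\ forall i, 0 <= l i, \sum_i l i = 1 & x = \sum_i l i *: a i]].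

(* The value is extended-real: -oo on an empty feasible set, +oo when the
   objective is unbounded above on it. *)
Definition max_value (R : realType) (T : Type) (f : T -> R) (S : set T) :
    \bar R :=
  ereal_sup [set (f x)%:E | x in S].

Section Problems.
Variables (R : realType) (n p : nat).
Variables (a0 : 'cV[R]_n) (a : 'I_p -> 'cV[R]_n) (b : 'I_p -> R).

Definition UQ_obj (x : 'cV[R]_n) : R := dotp x x - 2 * dotp a0 x.

Definition UQ_feasible : set 'cV[R]_n :=
  [set x | forall i, dotp x x - 2 * dotp (a i) x + b i <= 0].

Definition UQ_value : \bar R := max_value UQ_obj UQ_feasible.

Definition SDP_obj (xY : 'cV[R]_n * 'M[R]_n) : R :=
  \tr xY.2 - 2 * dotp a0 xY.1.

Definition SDP_feasible : set ('cV[R]_n * 'M[R]_n) :=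
  [set xY | [/\ xY.2^T = xY.2,
     forall i, \tr xY.2 - 2 * dotp (a i) xY.1 + b i <= 0
     & psdmx (block_mx xY.2 xY.1 xY.1^T (1%:M : 'M[R]_1))]].

Definition SDP_value : \bar R := max_value SDP_obj SDP_feasible.

End Problems.

(* Main.v *)
(* If (a_i - a_0)^T d >= 0 for all i and d <> 0, an SDP-feasible (x, Y) is
   rounded to a UQ-feasible point by moving from x along d until the objective
   has risen by the gap tr Y - x^T x >= 0: this raises each constraint function
   by at most that gap, so it stays below its value in the relaxation.
   Condition (i) provides such a d as well: take d = u - a_0 with u the point of
   conv {a_1, ..., a_p} nearest to a_0. *)
Require Import Defs.
From mathcomp Require Import all_boot all_order all_algebra.
From mathcomp Require Import all_classical all_reals all_analysis.
From mathcomp Require Import ring lra.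

Set Implicit Arguments.
Unset Strict Implicit.
Unset Printing Implicit Defensive.

Import Order.TTheory GRing.Theory Num.Theory.
Import numFieldNormedType.Exports.

Local Open Scope classical_set_scope.
Local Open Scope ring_scope.

(** * Bilinearity and positive definiteness of the dot product *)

Section DotProduct.
Variables (R : realType) (n : nat).
Implicit Types u v w : 'cV[R]_n.

Lemma dotpE u v : dotp u v = \sum_i u i 0 * v i 0.
Proof. by rewrite /dotp mxE; apply: eq_bigr => i _; rewrite mxE. Qed.

Lemma dotpC u v : dotp u v = dotp v u.
Proof. by rewrite !dotpE; apply: eq_bigr => i _; rewrite mulrC. Qed.

Lemma dotpDl u v w : dotp (u + v) w = dotp u w + dotp v w.
Proof. by rewrite /dotp linearD mulmxDl mxE. Qed.

Lemma dotpZl k u v : dotp (k *: u) v = k * dotp u v.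
Proof. by rewrite /dotp linearZ -scalemxAl mxE. Qed.

Lemma dotpBl u v w : dotp (u - v) w = dotp u w - dotp v w.
Proof. by rewrite -scaleN1r dotpDl dotpZl mulN1r. Qed.

Lemma dotpDr u v w : dotp w (u + v) = dotp w u + dotp w v.
Proof. by rewrite dotpC dotpDl !(dotpC w). Qed.

Lemma dotpZr k u v : dotp v (k *: u) = k * dotp v u.
Proof. by rewrite dotpC dotpZl dotpC. Qed.

Lemma dotp_ge0 u : 0 <= dotp u u.
Proof. by rewrite dotpE sumr_ge0// => i _; rewrite -expr2 sqr_ge0. Qed.

Lemma dotp_gt0 u : (0 < dotp u u) = (u != 0).
Proof.
rewrite lt_def dotp_ge0 andbT; congr (~~ _); apply/eqP/eqP => [|->]; last first.
  by rewrite dotpE big1// => i _; rewrite mxE mul0r.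
rewrite dotpE => /eqP; rewrite psumr_eq0 => [/allP u0|i _]; last first.
  by rewrite -expr2 sqr_ge0.
apply/colP => i; rewrite mxE; apply/eqP.
by have /implyP := u0 i (mem_index_enum i); rewrite mulf_eq0 orbb => ->.
Qed.

End DotProduct.

(** * Strict separation of a point from the hull of finitely many points *)

Section Separation.
Variables (R : realType) (n : nat).

Lemma sum_continuous (T : topologicalType) (I : Type) (r : seq I)
    (F : I -> T -> R) :
  (forall i, continuous (F i)) -> continuous (fun x => \sum_(i <- r) F i x).
Proof. by move=> cF; apply: continuous_big => //; exact: add_continuous. Qed.

Lemma dotp_lincomb_continuous p (a : 'I_p -> 'cV[R]_n) (x : 'cV[R]_n) :
  continuous (fun l : 'rV[R]_p =>
    dotp (\sum_i l 0 i *: a i - x) (\sum_i l 0 i *: a i - x)).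
Proof.
under eq_fun do rewrite dotpE.
apply: sum_continuous => j.
have cj : continuous (fun l : 'rV[R]_p => (\sum_i l 0 i *: a i - x) j 0).
  under eq_fun => l.
    rewrite !mxE summxE.
    under eq_bigr do rewrite mxE.
    over.
  have cs : continuous (fun l : 'rV[R]_p => \sum_i l 0 i * a i j 0).
    apply: sum_continuous => i l.
    apply: continuousM; last exact: cst_continuous.
    exact: coord_continuous.
  move=> l; apply: continuousB; last exact: cst_continuous.
  exact: cs.
by move=> l; apply: continuousM; exact: cj.
Qed.

Definition simplex p : set 'rV[R]_p :=
  [set l | (forall i, 0 <= l 0 i) /\ \sum_i l 0 i = 1].

(** A closed subset of the cube [[0, 1]^p]: as the other weights are nonnegative, no single one
    exceeds the total 1. *)
Lemma simplex_compact p : compact (@simplex p).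
Proof.
have box : compact [set l : 'rV[R]_p | forall i, `[0, 1]%classic (l ord0 i)].
  by apply: (@rV_compact _ p (fun=> `[(0 : R), 1]%classic)) => i;
    exact: segment_compact.
apply: subclosed_compact box _ => [|l [l0 l1] i /=]; last first.
  rewrite in_itv/= l0/= -l1 (bigD1 i)//= lerDl.
  by apply: sumr_ge0 => j _; exact: l0.
have -> : @simplex p =
    (\bigcap_(i in [set: 'I_p])
      ((fun l : 'rV[R]_p => l 0 i) @^-1` [set r | 0 <= r]))
    `&` ((fun l : 'rV[R]_p => \sum_i l 0 i) @^-1` [set 1]).
  by apply/seteqP; split => l [l0 l1]; split => //= i; [move=> _|]; exact: l0.
apply: closedI.
  apply: closed_bigI => i _; apply: (continuous_closedP _).1.
    exact: coord_continuous.
  exact: closed_ge.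
apply: (continuous_closedP _).1; last exact: closed_eq.
apply: sum_continuous => i; exact: coord_continuous.
Qed.

(* First-order condition at a minimizer [u] of the norm along a segment. *)
Lemma min_segment_dotp_ge0 (u w : 'cV[R]_n) :
  (forall s : R, 0 <= s <= 1 -> dotp u u <= dotp (u + s *: w) (u + s *: w)) ->
  0 <= dotp u w.
Proof.
move=> umin; rewrite leNgt; apply/negP => uw0.
have ww0 := dotp_ge0 w.
have d0 : 0 < dotp w w - dotp u w by lra.
(* The exact minimizer [- dotp u w / dotp w w] may exceed 1 or divide by 0. Enlarging the
   denominator by [- dotp u w > 0] keeps [s] in [(0, 1]], and the squared norm still changes by at
   most [s * dotp u w < 0]. *)
pose s := - dotp u w / (dotp w w - dotp u w).
have sE : s * (dotp w w - dotp u w) = - dotp u w.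
  by rewrite /s divfK// gt_eqF.
have s0 : 0 < s by rewrite /s divr_gt0// oppr_gt0.
have s1 : s <= 1 by rewrite /s ler_pdivrMr// mul1r; lra.
have := umin s; rewrite (ltW s0) s1 => /(_ isT).
rewrite !dotpDr !dotpDl !dotpZr !dotpZl (dotpC w u).
have sww : s * dotp w w <= - dotp u w.
  by rewrite -sE ler_pM2l//; lra.
nra.
Qed.

(** Take [d] of least norm in the hull translated by [- x]; it is nonzero because [x] is outside the
    hull. The first-order condition towards each vertex gives [dotp (a i - x) d >= dotp d d > 0]. *)
Lemma conv_hull_separation p (a : 'I_p -> 'cV[R]_n) (x : 'cV[R]_n) :
  ~ conv_hull a x -> exists d, forall i, 0 < dotp (a i - x) d.
Proof.
(* With no points the simplex is empty and has no minimizer, but the claim is vacuous. *)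
case: p a => [|p] a nax; first by exists 0 => -[].
pose pt (l : 'rV[R]_p.+1) := \sum_i l 0 i *: a i - x.
have simplex_delta i : simplex (delta_mx 0 i : 'rV[R]_p.+1).
  split=> [j|]; first by rewrite mxE ler0n.
  rewrite (bigD1 i)//= mxE !eqxx big1 ?addr0// => j ji.
  by rewrite mxE (negbTE ji) andbF.
have sum_delta i : \sum_j (j == i)%:R *: a j = a i.
  rewrite (bigD1 i)//= eqxx scale1r big1 ?addr0// => j /negbTE ->.
  by rewrite scale0r.
have pt_delta i : pt (delta_mx 0 i) = a i - x.
  by rewrite /pt; under eq_bigr do rewrite mxE eqxx/=; rewrite sum_delta.
have [||l /set_mem[l0 l1] lmin] :=
    @EVT_min_rV R p.+1 (fun l => dotp (pt l) (pt l)) _ _ (@simplex_compact p.+1).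
- by exists (delta_mx 0 ord0).
- exact/continuous_subspaceT/dotp_lincomb_continuous.
have u0 : pt l != 0.
  apply/eqP => /eqP; rewrite subr_eq0 => /eqP xE.
  by apply: nax; exists (l 0); split.
exists (pt l) => i.
have : 0 <= dotp (pt l) (pt (delta_mx 0 i) - pt l).
  apply: min_segment_dotp_ge0 => s /andP[s0 s1].
  (* [pt] is affine, so the segment towards a vertex lifts to a segment of weights, which stays in
     the simplex. *)
  have -> : pt l + s *: (pt (delta_mx 0 i) - pt l) =
            pt ((1 - s) *: l + s *: delta_mx 0 i).
    rewrite pt_delta /pt.
    under [in RHS]eq_bigr => j _.
      rewrite 4!mxE scalerDl -2!scalerA.
      over.
    rewrite big_split/= -!scaler_sumr sum_delta.
    by apply/colP => k; rewrite !mxE; ring.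
  apply: lmin; apply/mem_set.
  have [d0 d1] := simplex_delta i.
  split=> [j|].
    by rewrite 3!mxE addr_ge0// mulr_ge0// ?subr_ge0//; exact: d0.
  under eq_bigr => j _ do rewrite 3!mxE.
  by rewrite big_split/= -!mulr_sumr l1 d1 !mulr1 subrK.
rewrite pt_delta (dotpC (pt l)) (dotpBl (a i - x)) subr_ge0; apply: lt_le_trans.
by rewrite dotp_gt0.
Qed.

End Separation.

(** * Comparison of the two optimal values *)

Section Relaxation.
Variables (R : realType) (n p : nat).
Variables (a0 : 'cV[R]_n) (a : 'I_p -> 'cV[R]_n) (b : 'I_p -> R).

Lemma mxtrace_rank1 (x : 'cV[R]_n) : \tr (x *m x^T) = dotp x x.
Proof. by rewrite mxtrace_mulC /dotp /mxtrace big_ord1. Qed.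

(** The block matrix is [w *m w^T] with [w] the column [(x, 1)], so its quadratic form is a
    square. *)
Lemma psdmx_rank1 (x : 'cV[R]_n) :
  psdmx (block_mx (x *m x^T) x x^T (1%:M : 'M[R]_1)).
Proof.
have -> : block_mx (x *m x^T) x x^T (1%:M : 'M[R]_1) =
          col_mx x 1%:M *m (col_mx x 1%:M)^T.
  by rewrite tr_col_mx mul_col_row trmx1 !mulmx1 mul1mx.
split=> [|v]; first by rewrite trmx_mul trmxK.
set w := col_mx x _; rewrite mulmxA -mulmxA.
have -> : v^T *m w = (w^T *m v)^T by rewrite trmx_mul trmxK.
exact: dotp_ge0.
Qed.

Lemma UQ_value_le_SDP : (UQ_value a0 a b <= SDP_value a0 a b)%E.
Proof.
apply: ereal_sup_le => _ [x fx <-]; exists (x, x *m x^T).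
  split=> /=; first by rewrite trmx_mul trmxK.
    by move=> i; rewrite mxtrace_rank1; exact: fx.
  exact: psdmx_rank1.
by rewrite /SDP_obj /UQ_obj /= mxtrace_rank1.
Qed.

(* The [j]-th diagonal entry of the Schur complement [Y - x x^T] is the value
   of the form at [(e_j, - x_j)]. *)
Lemma psdmx_block_trace (Y : 'M[R]_n) (x : 'cV[R]_n) :
  psdmx (block_mx Y x x^T (1%:M : 'M[R]_1)) -> dotp x x <= \tr Y.
Proof.
move=> [_ psd]; rewrite dotpE /mxtrace; apply: ler_sum => j _.
have := psd (col_mx (delta_mx j 0) (- (x j 0)%:M)).
rewrite tr_col_mx mul_row_block mul_row_col trmx_delta linearN/= tr_scalar_mx.
rewrite !mulmxDl !mulNmx !mulmxN !mul_scalar_mx !mul_mx_scalar -!rowE.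
rewrite -colE -scalemxAl -[x^T *m _]colE !mxE.
rewrite eqxx/=.
lra.
Qed.

Lemma SDP_value_le_UQ (d : 'cV[R]_n) : d != 0 ->
  (forall i, 0 <= dotp (a i - a0) d) -> (SDP_value a0 a b <= UQ_value a0 a b)%E.
Proof.
rewrite -dotp_gt0 => dd0 da; apply: ge_ereal_sup => _ [[x Y] /= [_ fY psd] <-].
set A := dotp d d in dd0; pose B := dotp (x - a0) d; pose t := \tr Y - dotp x x.
have t0 : 0 <= t by rewrite subr_ge0 psdmx_block_trace.
have D0 : 0 <= B ^+ 2 + A * t.
  by rewrite addr_ge0 ?sqr_ge0 ?mulr_ge0 ?(ltW dd0).
(* The larger root of [A s^2 + 2 B s = t], whose left side is the increase of [UQ_obj] from [x] to
   [x + s *: d]. It is nonnegative since the square root is at least [|B|]. *)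
pose s := (Num.sqrt (B ^+ 2 + A * t) - B) / A.
have s0 : 0 <= s.
  rewrite divr_ge0 ?(ltW dd0)// subr_ge0 (le_trans (ler_norm B))// -sqrtr_sqr.
  by rewrite ler_wsqrtr// lerDl mulr_ge0 ?(ltW dd0).
have sE : s ^+ 2 * A + 2 * s * B = t.
  have As : A * s = Num.sqrt (B ^+ 2 + A * t) - B.
    by rewrite mulrC divfK// gt_eqF.
  apply: (mulfI (lt0r_neq0 dd0)).
  have : (A * s + B) ^+ 2 = B ^+ 2 + A * t by rewrite As subrK sqr_sqrtr.
  lra.
pose z := x + s *: d.
have zz : dotp z z = dotp x x + 2 * s * dotp x d + s ^+ 2 * A.
  by rewrite !dotpDr !dotpDl !dotpZr !dotpZl (dotpC d x) -/A; ring.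
move: sE; rewrite /B /t dotpBl => sE.
apply: ereal_sup_ubound; exists z; last first.
  congr EFin; rewrite /UQ_obj /SDP_obj /= zz dotpDr dotpZr; lra.
(* By the equation for [s], constraint [i] at [z] equals its relaxed value at [(x, Y)] minus
   [2 * s * dotp (a i - a0) d]. *)
move=> i; have := fY i; have := mulr_ge0 s0 (da i).
rewrite zz !dotpBl dotpDr dotpZr; lra.
Qed.

End Relaxation.

Theorem theorem5 (R : realType) (n p : nat) (n_gt0 : (0 < n)%N)
    (p_gt0 : (0 < p)%N)
    (a0 : 'cV[R]_n) (a : 'I_p -> 'cV[R]_n) (b : 'I_p -> R)
    (slater : interior (UQ_feasible a b) !=set0)
    (cond : ~ conv_hull a a0 \/
            [set x : 'cV[R]_n | forall i, 0 <= dotp (a i - a0) x] <> [set 0]) :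
  SDP_value a0 a b = UQ_value a0 a b.
Proof.
have dot0 v : dotp v (0 : 'cV[R]_n) = 0 by rewrite /dotp mulmx0 mxE.
have [d d0 da] : exists2 d : 'cV[R]_n, d != 0 & forall i, 0 <= dotp (a i - a0) d.
  case: cond => [/conv_hull_separation[d da]|cone].
    exists d => [|i]; last exact/ltW/da.
    (* Strict inequality at one index, available since [0 < p], excludes [d = 0]. *)
    by apply: contraTneq (da (Ordinal p_gt0)) => ->; rewrite dot0 ltxx.
  (* The cone always contains 0, so differing from [[set 0]] means having a nonzero element. *)
  apply: contrapT => nd; apply: cone; apply/seteqP; split => [d da|_ -> i].
    by apply: contrapT => /eqP d0; apply: nd; exists d.
  by rewrite dot0.
by apply/eqP; rewrite eq_le UQ_value_le_SDP (SDP_value_le_UQ b d0 da).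
Qed.
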